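(* Let $T$ be a singular $n\times n$ upper triangular complex pencil such that (1) the normal rank of $T$ is $n-1$ and (2) $T$ has no eigenvalues (finite or infinite). Let the uppermost zero diagonal element of $T$ be located at position $(k+1,k+1)$. Then the right minimal index of $T$ is $k$.
   Context: An $n\times n$ complex pencil is $T=A+\lambda B$ with $A,B\in\mathbb{C}^{n\times n}$; it is singular if $\det(A+\lambda B)\equiv 0$. Its normal rank is its rank over the field $\mathbb{C}(\lambda)$ of rational functions. An element $\mu\in\mathbb{C}\cup\{\infty\}$ is an eigenvalue of $A+\lambda B$ if $\operatorname{rank}(A+\mu B)$ is strictly smaller than the normal rank, with the convention $A+\infty B:=B$. If the pencil has normal rank $n-1$, its right null space over $\mathbb{C}(\lambda)$ is one-dimensional, and its (unique) right minimal index is the smallest degree among the nonzero polynomial vectors in this null space. *)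

(* Defs.v *)
From HB Require Import structures.
From mathcomp Require Import all_boot all_order all_algebra.
From mathcomp Require Import complex.
From mathcomp Require Import reals.

Set Implicit Arguments.
Unset Strict Implicit.
Unset Printing Implicit Defensive.

Import Order.TTheory GRing.Theory Num.Theory.
Local Open Scope ring_scope.

Section Pencils.
Variables (F : fieldType) (n : nat).
Implicit Types (A B : 'M[F]_n) (T : 'M[{poly F}]_n).

(* A + lambda B, where the polynomial variable 'X plays the role of lambda. *)
Definition pencil A B : 'M[{poly F}]_n :=
  map_mx polyC A + 'X *: map_mx polyC B.

Definition singular_pencil A B : Prop := \det (pencil A B) = 0.

(* The pencil as a matrix over the field F(lambda) of rational functions. *)
Definition rat_pencil A B : 'M[{fraction {poly F}}]_n :=
  map_mx (@tofrac {poly F}) (pencil A B).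

Definition normal_rank A B : nat := \rank (rat_pencil A B).

(* Points of the projective line F \cup {oo}: None stands for oo. *)
Definition pencil_at A B (mu : option F) : 'M[F]_n :=
  if mu is Some z then A + z *: B else B.

Definition pencil_eigenvalue A B (mu : option F) : Prop :=
  (\rank (pencil_at A B mu) < normal_rank A B)%N.

Definition upper_triangular T : Prop :=
  forall i j : 'I_n, (j < i)%N -> T i j = 0.

(* Degree of a polynomial vector: the largest degree of its entries
   (only meaningful for nonzero vectors). *)
Definition polyvec_degree (v : 'cV[{poly F}]_n) : nat :=
  (\max_(i < n) size (v i 0%R)).-1.

Definition in_right_null_space A B (v : 'cV[{poly F}]_n) : Prop :=
  rat_pencil A B *m map_mx (@tofrac {poly F}) v = 0.

(* To be used for pencils of normal rank n - 1, which have exactly one right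
   minimal index. *)
Definition right_minimal_index A B (d : nat) : Prop :=
  (exists v : 'cV[{poly F}]_n,
      [/\ v != 0, in_right_null_space A B v & polyvec_degree v = d]) /\
  (forall w : 'cV[{poly F}]_n,
      w != 0 -> in_right_null_space A B w -> (d <= polyvec_degree w)%N).

End Pencils.

(* Main.v *)
Require Import Defs.
From mathcomp Require Import all_boot all_order all_algebra.
From mathcomp Require Import complex.
From mathcomp Require Import reals.
From mathcomp Require Import perm.

Import GRing.Theory.
Local Open Scope ring_scope.

(** Let M be the k x (k+1) pencil formed by the first k rows and the first k+1
    columns of T. Since T is triangular and T k k = 0, the first k+1 columns of
    T vanish outside the rows of M. Two consequences follow.

    - A null vector of M, padded by zeros, is a null vector of T. The vector of
      signed maximal minors of M ([maxminors]) is such a null vector, and its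
      entries have degree at most k.
    - Splitting off the last n-k-1 columns gives
      rank T(mu) <= rank M(mu) + n-k-1 ([rank_zero_corner]). As T has
      normal rank n-1 and no eigenvalues, M(mu) has full row rank k at every mu,
      infinity included.

    A full-rank matrix has a nonzero maximal minor ([maxminors_neq0]). At
    infinity this gives the padded vector v degree exactly k, because the
    coefficients of degree k of the minors of A + lambda B are the minors of B.
    At the finite points it says that the entries of v have no common root.
    The right null space being a line over the rational functions, every
    polynomial null vector is a rational multiple of v; over an algebraically
    closed field a nonconstant reduced denominator of this multiplier would have
    a root common to all the entries of v, so the multiplier is a polynomial
    ([size_primitive_le]) and no null vector has degree below k. *)

(** * Signed maximal minors *)

Section MaximalMinors.
Context {k : nat}.

Definition maxminors {R : pzRingType} (M : 'M[R]_(k, k.+1)) : 'cV[R]_k.+1 :=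
  \col_j ((-1) ^+ j * \det (col' j M)).

(** Laplace expansion along the added row. *)
Lemma mul_maxminors {R : comPzRingType} (u : 'rV[R]_k.+1)
    (M : 'M[R]_(k, k.+1)) :
  (u *m maxminors M) 0 0 = \det (col_mx u M : 'M_k.+1).
Proof.
rewrite (expand_det_row (col_mx u M : 'M_k.+1) ord0) mxE.
apply: eq_bigr => j _; rewrite mxE /cofactor add0n.
have e0 : u 0 j = (col_mx u M : 'M_k.+1) ord0 j.
  by rewrite -(col_mxEu u M); congr (col_mx u M _ j); apply: val_inj.
rewrite -e0; congr (_ * _); congr (_ * _); congr (\det _).
apply/matrixP=> a b; rewrite !mxE.
case: splitP => [c|c] /=; first by rewrite (ord1 c).
by move=> /eqP; rewrite /bump /= add1n add1n eqSS => /eqP/val_inj->.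
Qed.

(** Bordering M with one of its own rows produces a repeated row. *)
Lemma maxminors_null {R : comPzRingType} (M : 'M[R]_(k, k.+1)) :
  M *m maxminors M = 0.
Proof.
apply/matrixP=> i j; rewrite (ord1 j) [RHS]mxE.
transitivity ((row i M *m maxminors M) 0 0).
  by rewrite !mxE; apply: eq_bigr => l _; rewrite [in RHS]mxE.
rewrite mul_maxminors.
apply: (@determinant_alternate _ _ _ (lshift k 0) (rshift 1 i)) => [|l].
  by rewrite eq_shift.
by rewrite col_mxEu col_mxEd mxE.
Qed.

Lemma map_maxminors {R S : comPzRingType} (f : {rmorphism R -> S})
    (M : 'M[R]_(k, k.+1)) :
  map_mx f (maxminors M) = maxminors (map_mx f M).
Proof.
apply/matrixP=> i j.
rewrite !mxE rmorphM rmorphXn rmorphN1 -det_map_mx.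
congr (_ * \det _); exact: (map_col' f M i).
Qed.

(** Bordering M with a row outside its row space gives an invertible matrix,
    whose determinant is a combination of the maximal minors. *)
Lemma maxminors_neq0 {F : fieldType} (M : 'M[F]_(k, k.+1)) :
  \rank M = k -> maxminors M != 0.
Proof.
move=> rM; have /row_subPn[i nu] : ~~ ((1%:M : 'M_k.+1) <= M)%MS.
  apply/negP=> /mxrankS; rewrite mxrank1 rM ltnn //.
set u := row i 1%:M in nu.
apply: contraNneq nu => v0.
have d0 : \det (col_mx u M : 'M_k.+1) = 0.
  by rewrite -mul_maxminors v0 mulmx0 mxE.
apply/negPn/negP=> nu.
have ltM : (M < u + M)%MS.
  rewrite /ltmx addsmxSr /=; apply: contra nu => h.
  by apply: submx_trans h; apply: addsmxSl.
have := rank_ltmx ltM; rewrite rM addsmxE ltnNge => /negP; apply.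
rewrite leqNgt; apply/negP=> hr.
have: (col_mx u M : 'M_k.+1) \in unitmx.
  by rewrite -row_free_unit /row_free eqn_leq rank_leq_row.
by rewrite unitmxE d0 unitr0.
Qed.

End MaximalMinors.

(** * Degrees of determinants of pencils *)

Section PencilDeterminant.
Context {F : fieldType}.

Lemma prod_linear_coef (I : Type) (s : seq I) (a b : I -> F) :
  (size (\prod_(i <- s) ((a i)%:P + 'X * (b i)%:P))%R <= (size s).+1)%N /\
  (\prod_(i <- s) ((a i)%:P + 'X * (b i)%:P))`_(size s) = \prod_(i <- s) b i.
Proof.
elim: s => [|x s [IHs IHc]]; first by rewrite !big_nil size_poly1 coef1.
rewrite !big_cons /= mulrDl -mulrA.
set p := \prod_(i <- s) _ in IHs IHc *; split.
  rewrite (leq_trans (size_polyD _ _)) // geq_max mul_polyC.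
  rewrite (leq_trans (size_scale_leq _ _)) ?(leq_trans IHs) //.
  rewrite mulrC mul_polyC -scalerAl.
  rewrite (leq_trans (size_scale_leq _ _)) //.
  by rewrite (leq_trans (size_polyMleq _ _)) // size_polyX addn2.
rewrite coefD !coefCM coefXM /= coefCM IHc.
by rewrite [X in _ * X]nth_default // mulr0 add0r.
Qed.

(** Seen as a form of degree k, the determinant takes the value det B at
    infinity. *)
Lemma det_pencil_coef k (A B : 'M[F]_k) :
  (size (\det (pencil A B)) <= k.+1)%N /\ (\det (pencil A B))`_k = \det B.
Proof.
have sk : size (index_enum 'I_k) = k.
  by rewrite [index_enum _]unlock -enumT size_enum_ord.
have prodE (s : 'S_k) : \prod_i pencil A B i (s i) =
    \prod_(i <- index_enum 'I_k) ((A i (s i))%:P + 'X * (B i (s i))%:P).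
  by apply: eq_bigr => i _; rewrite !mxE.
have H (s : 'S_k) := prod_linear_coef _ (index_enum 'I_k)
  (fun i => A i (s i)) (fun i => B i (s i)).
split.
  apply: (leq_trans (size_sum _ _ _)); apply/bigmax_leqP=> s _.
  have [szs _] := H s; rewrite prodE mulr_sign -[X in (_ <= X.+1)%N]sk.
  by case: ifP => _; rewrite ?size_polyN.
rewrite coef_sum; apply: eq_bigr => s _.
have [_] := H s; rewrite sk prodE !mulr_sign => <-.
by case: ifP => _; rewrite ?coefN.
Qed.

End PencilDeterminant.

(** * Triangular pencils with a zero on the diagonal *)

Section ZeroCorner.
Context {n : nat} (k : 'I_n).

Definition corner {T : Type} (S : 'M[T]_n) : 'M[T]_(k, k.+1) :=
  mxsub (widen_ord (ltnW (ltn_ord k))) (widen_ord (ltn_ord k)) S.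

(** The shape forced on an upper triangular S by S k k = 0. *)
Definition zero_corner {V : nmodType} (S : 'M[V]_n) : Prop :=
  forall i j : 'I_n, (k <= i)%N -> (j <= k)%N -> S i j = 0.

Lemma mul_zero_corner {R : pzRingType} (S : 'M[R]_n) : zero_corner S ->
  S *m pid_mx k.+1 = (pid_mx k : 'M_(n, k)) *m corner S.
Proof.
move=> zS; rewrite -[pid_mx k.+1]pid_mx_minv minnC pid_mx_minh.
rewrite (pid_mxEcol _ (ltn_ord k)) mulmx_colsub mulmx1.
apply/matrixP=> i j; rewrite !mxE.
have [lt_ik|le_ki] := ltnP i k.
  rewrite (bigD1 (Ordinal lt_ik)) //= big1 => [|l /negPf nl].
    by rewrite !mxE /= eqxx lt_ik mul1r addr0; congr (S _ _); apply: val_inj.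
  by rewrite !mxE eq_sym [_ == _]nl mul0r.
rewrite zS //= ?big1 // => [l _|]; last by rewrite -ltnS.
by rewrite mxE ltnNge le_ki andbF mul0r.
Qed.

Lemma pid_mul_widen {R : pzRingType} (v : 'cV[R]_k.+1) (j : 'I_k.+1) :
  (pid_mx k.+1 *m v : 'cV_n) (widen_ord (ltn_ord k) j) 0 = v j 0.
Proof.
rewrite mxE (bigD1 j) //= big1 => [|l /negPf nl].
  by rewrite mxE /= eqxx ltn_ord mul1r addr0.
by rewrite mxE /= eq_sym [_ == _]nl mul0r.
Qed.

Lemma pid_mul_out {R : pzRingType} (v : 'cV[R]_k.+1) (i : 'I_n) :
  (k < i)%N -> (pid_mx k.+1 *m v : 'cV_n) i 0 = 0.
Proof.
move=> ki; rewrite mxE big1 // => l _.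
by rewrite mxE ltnS leqNgt ki andbF mul0r.
Qed.

Lemma rank_zero_corner {F : fieldType} (S : 'M[F]_n) : zero_corner S ->
  (\rank S <= \rank (corner S) + (n - k.+1))%N.
Proof.
move=> zS.
have SE : S = S *m pid_mx k.+1 *m (pid_mx k.+1 : 'M_(k.+1, n))
            + S *m copid_mx k.+1.
  by rewrite -mulmxA pid_mx_id // -mulmxDr addrC subrK mulmx1.
rewrite [X in (\rank X <= _)%N]SE.
rewrite (leq_trans (mxrank_add _ _)) // mul_zero_corner // leq_add //.
  by rewrite (leq_trans (mxrankM_maxl _ _)) // mxrankM_maxr.
by rewrite (leq_trans (mxrankM_maxr _ _)) // rank_copid_mx.
Qed.

End ZeroCorner.

(** * Comparing null vectors *)

(** The cross products express proportionality without the factor, which over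
    the rational functions need not be a polynomial. *)
Lemma corank1_ker_proportional {F : fieldType} {n : nat} (P : 'M[F]_n)
    (x y : 'cV[F]_n) :
  \rank P = n.-1 -> x != 0 -> P *m x = 0 -> P *m y = 0 ->
  forall i j, x j 0 * y i 0 = y j 0 * x i 0.
Proof.
move=> rP x0 Px Py i j.
have ker (z : 'cV_n) : P *m z = 0 -> (z^T <= kermx P^T)%MS.
  by move=> Pz; apply/sub_kermxP; rewrite -trmx_mul Pz trmx0.
have rx : \rank x^T = 1%N by rewrite rank_rV trmx_eq0 x0.
have /sub_rVP[c yE] : (y^T <= x^T)%MS.
  apply: submx_trans (ker y Py) _.
  have [_ <-] := mxrank_leqif_sup (ker x Px).
  by rewrite rx mxrank_ker mxrank_tr rP -subn1 subKn //
    (leq_ltn_trans _ (ltn_ord i)).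
have yxE l : y l 0 = c * x l 0 by have /rowP/(_ l) := yE; rewrite !mxE.
by rewrite !yxE mulrCA mulrA.
Qed.

(** Over an algebraically closed field, entries without common root are
    coprime; in b * w = a * v with a and b coprime, b divides every entry of v
    and is thus constant. *)
Lemma size_primitive_le {F : closedFieldType} {n : nat}
    (v w : 'cV[{poly F}]_n) :
  (forall z, exists i, ~~ root (v i 0) z) -> w != 0 ->
  (forall i j, v j 0 * w i 0 = w j 0 * v i 0) ->
  forall i, (size (v i 0%R) <= size (w i 0%R))%N.
Proof.
move=> prim w0 vw i.
have [j vj] := prim 0.
have vj0 : v j 0 != 0 by apply: contraNneq vj => ->; rewrite root0.
have wj0 : w j 0 != 0.
  apply: contraNneq w0 => wj; apply/eqP/colP=> l; rewrite mxE.
  by apply/eqP; have /eqP := vw l j; rewrite wj mul0r mulf_eq0 (negPf vj0).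
pose g := gcdp (v j 0) (w j 0); pose b := v j 0 %/ g; pose a := w j 0 %/ g.
have bE : v j 0 = b * g by rewrite divpK // dvdp_gcdl.
have aE : w j 0 = a * g by rewrite divpK // dvdp_gcdr.
have g0 : g != 0 by rewrite gcdp_eq0 negb_and vj0.
have a0 : a != 0 by apply: contraNneq wj0 => a0; rewrite aE a0 mul0r.
have cop : coprimep b a by rewrite coprimep_div_gcd ?vj0.
have bw l : b * w l 0 = a * v l 0.
  by apply: (mulIf g0); rewrite mulrAC -bE vw aE mulrAC.
have bv l : b %| v l 0 by rewrite -(Gauss_dvdpr _ cop) -bw dvdp_mulIl.
have sb : size b = 1%N.
  apply/eqP/negPn/negP=> /closed_rootP[z bz].
  have [l /negP[]] := prim z.
  exact: root_dvdp bz.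
have b0 : b != 0 by rewrite -size_poly_gt0 sb.
have [->|vi0] := eqVneq (v i 0) 0; first by rewrite size_poly0.
have -> : size (w i 0%R) = size (b * w i 0).
  by move/eqP: sb => /size_poly1P[c c0 ->]; rewrite mul_polyC size_scale.
rewrite bw size_mul // -subn1 -addnBAC ?size_poly_gt0 //.
by rewrite leq_addl.
Qed.

(** * The minimal index *)

Section ZeroCornerPencil.
Context {F : fieldType} {n : nat} (A B : 'M[F]_n) (k : 'I_n).

Lemma zero_corner_pencil : zero_corner k (pencil A B) ->
  zero_corner k A /\ zero_corner k B.
Proof.
move=> zT; split=> i j ki jk; have := zT i j ki jk; rewrite !mxE.
  by move/(congr1 (fun p : {poly F} => p`_0));
    rewrite coefD coefC coefXM coef0 addr0.
by move/(congr1 (fun p : {poly F} => p`_1));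
  rewrite coefD coefC coefXM coefC coef0 add0r.
Qed.

Lemma horner_pencil z :
  map_mx (horner_eval z) (pencil A B) = A + z *: B.
Proof.
by apply/matrixP=> i j; rewrite !mxE /horner_eval !hornerE.
Qed.

Lemma maxminors_pencil_coef (j : 'I_k.+1) :
  (size (maxminors (corner k (pencil A B)) j 0%R) <= k.+1)%N /\
  (maxminors (corner k (pencil A B)) j 0)`_k = maxminors (corner k B) j 0.
Proof.
rewrite !mxE.
have -> : col' j (corner k (pencil A B)) =
          pencil (col' j (corner k A)) (col' j (corner k B)).
  by apply/matrixP=> a b; rewrite !mxE.
have [szd cfd] := det_pencil_coef _ (col' j (corner k A)) (col' j (corner k B)).
have signE (R : pzRingType) (x : R) : (-1) ^+ j * x = if odd j then - x else x.
  by rewrite -signr_odd mulr_sign.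
by rewrite !signE; case: ifP => _; rewrite ?size_polyN ?coefN cfd.
Qed.

(** By [rank_zero_corner], a rank drop of the corner is a rank drop of the
    pencil, i.e. an eigenvalue. *)
Lemma rank_corner_at (mu : option F) : zero_corner k (pencil A B) ->
  normal_rank A B = n.-1 -> ~ pencil_eigenvalue A B mu ->
  \rank (corner k (pencil_at A B mu)) = k.
Proof.
move=> /zero_corner_pencil[zA zB] rk /negP.
rewrite /pencil_eigenvalue rk -leqNgt => le.
have zS : zero_corner k (pencil_at A B mu).
  case: mu {le} => [z|] //= i j ki jk.
  by rewrite !mxE zA // zB // mulr0 addr0.
apply/eqP; rewrite eqn_leq rank_leq_row /=.
have kn : (n.-1 = k + (n - k.+1))%N.
  by rewrite -subn1 -[in LHS](subnKC (ltn_ord k)) addSn subSS subn0.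
by have := leq_trans le (rank_zero_corner _ _ zS); rewrite kn leq_add2r.
Qed.

End ZeroCornerPencil.

Lemma zero_corner_minimal_index {F : closedFieldType} {n : nat}
    (A B : 'M[F]_n) (k : 'I_n) :
  zero_corner k (pencil A B) -> normal_rank A B = n.-1 ->
  (forall mu, ~ pencil_eigenvalue A B mu) ->
  right_minimal_index A B k.
Proof.
move=> zT rk noeig.
have minors_at mu : maxminors (corner k (pencil_at A B mu)) != 0.
  by apply: maxminors_neq0; apply: rank_corner_at.
set m := maxminors (corner k (pencil A B)).
pose v : 'cV_n := pid_mx k.+1 *m m.
have vE j : v (widen_ord (ltn_ord k) j) 0 = m j 0 := pid_mul_widen k m j.
have Tv : pencil A B *m v = 0.
  by rewrite mulmxA mul_zero_corner // -mulmxA maxminors_null mulmx0.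
have nullv : in_right_null_space A B v.
  by rewrite /in_right_null_space -map_mxM Tv map_mx0.
have size_v i : (size (v i 0%R) <= k.+1)%N.
  have [ki|ik] := ltnP k i; first by rewrite /v pid_mul_out // size_poly0.
  pose i' : 'I_k.+1 := Ordinal (ik : (i < k.+1)%N).
  have -> : i = widen_ord (ltn_ord k) i' by apply: val_inj.
  by rewrite vE; case: (maxminors_pencil_coef A B k i').
(* Nonvanishing of the minors at infinity. *)
have [j top] : exists j, size (v j 0%R) = k.+1.
  have /cV0Pn[j mj] := minors_at None.
  exists (widen_ord (ltn_ord k) j); apply/eqP; rewrite eqn_leq size_v /=.
  rewrite vE ltnNge; apply: contra mj => /leq_sizeP/(_ k (leqnn k)).
  by case: (maxminors_pencil_coef A B k j) => _ -> ->.
have v0 : v != 0.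
  by apply/cV0Pn; exists j; rewrite -size_poly_gt0 top.
(* Nonvanishing of the minors at the finite points. *)
have prim z : exists i, ~~ root (v i 0) z.
  have /cV0Pn[l ml] := minors_at (Some z).
  exists (widen_ord (ltn_ord k) l); rewrite vE; apply: contra ml => /eqP mz0.
  have -> : maxminors (corner k (pencil_at A B (Some z))) =
            map_mx (horner_eval z) m.
    by rewrite map_maxminors map_mxsub horner_pencil.
  by rewrite [X in X == 0]mxE /horner_eval mz0.
split.
  exists v; split=> //; rewrite /polyvec_degree.
  rewrite (_ : \max_(i < n) _ = k.+1) //; apply/eqP.
  rewrite eqn_leq; apply/andP; split; first exact/bigmax_leqP.
  by rewrite -[X in (X <= _)%N]top (leq_bigmax j).
move=> w w0 nullw.
have vw i l : v l 0 * w i 0 = w l 0 * v i 0.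
  have fv0 : map_mx (@tofrac {poly F}) v != 0.
    by apply/cV0Pn; exists j; rewrite mxE tofrac_eq0 -size_poly_gt0 top.
  have := corank1_ker_proportional _ _ _ rk fv0 nullv nullw i l.
  by rewrite !mxE -!tofracM => /eqP; rewrite tofrac_eq => /eqP.
have := size_primitive_le _ _ prim w0 vw j; rewrite top => le_w.
rewrite /polyvec_degree -ltnS; apply: leq_trans le_w _.
by rewrite (leq_trans _ (leqSpred _)) // (leq_bigmax j).
Qed.

(* k : 'I_n is 0-based, so the diagonal entry (k, k) below is the entry at
   position (k+1, k+1) in 1-based numbering. *)
Theorem lemma5p2 (R : realType) (n : nat) (A B : 'M[R[i]]_n) (k : 'I_n)
    (hsing : singular_pencil A B)
    (htri : upper_triangular (pencil A B))
    (hrank : normal_rank A B = n.-1)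
    (hnoeig : forall mu : option R[i], ~ pencil_eigenvalue A B mu)
    (hkk : pencil A B k k = 0)
    (hk : forall j : 'I_n, (j < k)%N -> pencil A B j j <> 0) :
  right_minimal_index A B k.
Proof.
apply: zero_corner_minimal_index => // i j ki jk.
have [ltji|leij] := ltnP j i; first exact: htri.
have ik : i = k by apply/val_inj/eqP; rewrite eqn_leq ki (leq_trans leij).
by rewrite (_ : j = k) ?ik //; apply/val_inj/eqP; rewrite eqn_leq jk -ik.
Qed.
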